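(* Let $B_N$ be the set of all nontrivial elements of the free group $F_k$ having length no more than $N$ in the generators. For $g\in B_N$ let $i(g)$ be the minimal index of a subgroup of $F_k$ not containing $g$. Then the average of $i(g)$ over $g\in B_N$ is bounded above by a constant independent of $N$ (which can be taken to be approximately $2.92$).
   Context: Length in $F_k$ is word length with respect to the free generators. The average is $\frac{1}{|B_N|}\sum_{g\in B_N} i(g)$. *)

(* Defs.v *)
From HB Require Import structures.
From mathcomp Require Import all_boot all_order all_fingroup all_algebra.
From mathcomp Require Import all_classical all_reals.

Set Implicit Arguments.
Unset Strict Implicit.
Unset Printing Implicit Defensive.

Local Open Scope classical_set_scope.
Local Open Scope group_scope.

(* The letter (i, false) stands for the i-th free generator and (i, true) for
   its inverse. *)
Notation letter k := ('I_k * bool)%type.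

Definition letter_inv k (x : letter k) : letter k := (x.1, ~~ x.2).

Definition reduced k (w : seq (letter k)) : bool :=
  sorted (fun x y => y != letter_inv x) w.

Record free_group (k : nat) : Type :=
  FreeGroup { word :> seq (letter k); word_reduced : reduced word }.

HB.instance Definition _ k := [isSub for @word k].
HB.instance Definition _ k := [Choice of free_group k by <:].

(* Left multiplication by a letter, on reduced words. *)
Definition push k (x : letter k) (w : seq (letter k)) : seq (letter k) :=
  if w is y :: w' then if y == letter_inv x then w' else x :: w else [:: x].

(* Reduction of the concatenation [u ++ w], for [w] reduced. *)
Definition push_word k (u w : seq (letter k)) : seq (letter k) :=
  foldr (@push k) w u.

Definition word_inv k (w : seq (letter k)) : seq (letter k) :=
  rev [seq letter_inv x | x <- w].

Section FreeGroupTheory.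
Variable k : nat.
Implicit Types (x y : letter k) (u v w : seq (letter k)).

Lemma letter_invK : involutive (@letter_inv k).
Proof. by case=> i b; rewrite /letter_inv /= negbK. Qed.

Lemma push_reduced x w : reduced w -> reduced (push x w).
Proof.
case: w => [|y w] //= rw; case: eqVneq => [_|nyx]; first exact: path_sorted rw.
by rewrite /reduced /= nyx.
Qed.

Lemma pushK x w : reduced w -> push (letter_inv x) (push x w) = w.
Proof.
case: w => [|y w] /=; first by rewrite letter_invK eqxx.
case: eqVneq => [-> |_] /=; last by rewrite letter_invK eqxx.
case: w => [|z w] //=; rewrite /reduced /= letter_invK => /andP[nzx _].
by rewrite (negPf nzx).
Qed.

Lemma push_word_reduced u w : reduced w -> reduced (push_word u w).
Proof. by move=> rw; elim: u => //= x u; apply: push_reduced. Qed.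

Lemma push_word_push x u w :
  reduced u -> reduced w -> push_word (push x u) w = push x (push_word u w).
Proof.
case: u => [|y u] //= ru rw; case: eqVneq => [->|_] //=.
rewrite -{1}[x]letter_invK pushK //.
exact: push_word_reduced.
Qed.

Lemma push_wordA u v w : reduced v -> reduced w ->
  push_word u (push_word v w) = push_word (push_word u v) w.
Proof.
move=> rv rw; elim: u => //= x u ->.
by rewrite push_word_push //; apply: push_word_reduced.
Qed.

Lemma push_words0 u : reduced u -> push_word u [::] = u.
Proof.
elim: u => //= x u IHu ru; rewrite (IHu (path_sorted ru)).
by case: u ru {IHu} => //= y u; rewrite /reduced /= => /andP[/negPf-> _].
Qed.

Lemma word_inv_reduced w : reduced w -> reduced (word_inv w).
Proof.
rewrite /reduced /word_inv rev_sorted sorted_map; apply: sub_sorted => x y /=.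
by apply: contraNneq => ->; rewrite !letter_invK.
Qed.

Lemma word_invK : involutive (@word_inv k).
Proof.
by move=> w; rewrite /word_inv map_rev revK -map_comp map_id_in// => x _ /=;
   exact: letter_invK.
Qed.

Lemma push_wordVK u w : reduced w -> push_word (word_inv u) (push_word u w) = w.
Proof.
move=> rw; elim: u w rw => [|x u IHu] w rw //=.
rewrite /word_inv map_cons rev_cons -cats1 /push_word foldr_cat /=.
by rewrite pushK; [apply: IHu | apply: push_word_reduced].
Qed.

Lemma size_push x w : size (push x w) <= (size w).+1.
Proof. by case: w => //= y w; case: ifP => // _; rewrite ltnW. Qed.

Lemma size_push_word u w : size (push_word u w) <= size u + size w.
Proof.
by elim: u => //= x u IHu; apply: leq_trans (size_push _ _) _; rewrite addSn.
Qed.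

Definition fg_one : free_group k := @FreeGroup k [::] isT.
Definition fg_mul (g h : free_group k) : free_group k :=
  FreeGroup (push_word_reduced g (word_reduced h)).
Definition fg_inv (g : free_group k) : free_group k :=
  FreeGroup (word_inv_reduced (word_reduced g)).

Lemma fg_mulA : associative fg_mul.
Proof. by move=> f g h; apply: val_inj; apply: push_wordA (valP g) (valP h). Qed.
Lemma fg_mul1 : left_id fg_one fg_mul.
Proof. by move=> g; apply: val_inj. Qed.
Lemma fg_mulr1 : right_id fg_one fg_mul.
Proof. by move=> g; apply: val_inj; apply: push_words0 (valP g). Qed.
Lemma fg_mulV : left_inverse fg_one fg_inv fg_mul.
Proof.
move=> g; apply: val_inj => /=.
by rewrite -{2}[word g]push_words0 ?push_wordVK// word_reduced.
Qed.
Lemma fg_mulrV : right_inverse fg_one fg_inv fg_mul.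
Proof.
move=> g; rewrite -{1}[g](_ : fg_inv (fg_inv g) = g) ?fg_mulV//.
by apply: val_inj; apply: word_invK.
Qed.

HB.instance Definition _ := isGroup.Build (free_group k)
  fg_mulA fg_mul1 fg_mulr1 fg_mulV fg_mulrV.

Definition fg_letter (x : letter k) : free_group k :=
  @FreeGroup k [:: x] isT.
Definition fg_gen (i : 'I_k) : free_group k := fg_letter (i, false).

(* By [word_lengthP] below, this is the least number of generators and inverses
   of generators whose product is [g]. *)
Definition word_length (g : free_group k) : nat := size (word g).

Lemma fg_letterE x :
  fg_letter x = if x.2 then (fg_gen x.1)^-1 else fg_gen x.1.
Proof. by case: x => i [] //; apply: val_inj. Qed.

Lemma word_prod u : word (\prod_(x <- u) fg_letter x) = push_word u [::].
Proof. by elim: u => [|x u IHu]; rewrite ?big_nil ?big_cons //= IHu. Qed.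

Lemma prod_word (g : free_group k) : \prod_(x <- word g) fg_letter x = g.
Proof.
by apply: val_inj; rewrite /= word_prod push_words0 // word_reduced.
Qed.

Lemma word_lengthP (g : free_group k) n :
  reflect (exists2 u, size u <= n & g = \prod_(x <- u) fg_letter x)
          (word_length g <= n).
Proof.
apply: (iffP idP) => [le_g_n|[u le_u_n ->]].
  by exists (word g); rewrite ?prod_word.
rewrite /word_length word_prod (leq_trans (size_push_word _ _))//.
by rewrite addn0.
Qed.

(* Universal property. *)
Section Lift.
Variables (G : groupType) (f : 'I_k -> G).

Definition lift_letter x : G := if x.2 then (f x.1)^-1 else f x.1.

Definition fg_lift (g : free_group k) : G := \prod_(x <- word g) lift_letter x.

Lemma lift_letterV x : lift_letter (letter_inv x) = (lift_letter x)^-1.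
Proof. by case: x => i [] //=; rewrite /lift_letter /= invgK. Qed.

Lemma fg_lift_gen i : fg_lift (fg_gen i) = f i.
Proof. by rewrite /fg_lift big_seq1. Qed.

Lemma fg_liftM : {morph fg_lift : g h / g * h}.
Proof.
move=> g h; rewrite /fg_lift /=; elim: (word g) => [|x u IHu] /=.
  by rewrite big_nil mul1g.
rewrite big_cons -mulgA -IHu; case: (push_word u h) => [|y w] /=.
  by rewrite big_seq1 big_nil mulg1.
case: eqVneq => [->|_]; last by rewrite !big_cons.
by rewrite big_cons lift_letterV mulVKg.
Qed.

Lemma fg_lift1 : fg_lift 1 = 1. Proof. exact: big_nil. Qed.

Lemma fg_liftV g : fg_lift g^-1 = (fg_lift g)^-1.
Proof. by apply: (mulgI (fg_lift g)); rewrite -fg_liftM !mulgV fg_lift1. Qed.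

Lemma fg_lift_uniq (phi : free_group k -> G) :
  {morph phi : g h / g * h} -> (forall i, phi (fg_gen i) = f i) ->
  phi =1 fg_lift.
Proof.
move=> phiM phi_gen g.
have phi1 : phi 1 = 1 by apply: (mulgI (phi 1)); rewrite -phiM !mulg1.
have phiV h : phi h^-1 = (phi h)^-1.
  by apply: (mulgI (phi h)); rewrite -phiM !mulgV phi1.
rewrite -{1}[g]prod_word /fg_lift; elim: (word g) => [|x u IHu].
  by rewrite !big_nil.
rewrite !big_cons phiM IHu; congr (_ * _).
by rewrite fg_letterE /lift_letter; case: x => i [] /=; rewrite ?phiV phi_gen.
Qed.

End Lift.

End FreeGroupTheory.

Definition left_cosets (G : groupType) (H : {pred G}) : set (set G) :=
  [set [set x * h | h in [set` H]] | x in [set: G]].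

Definition has_index (G : groupType) (H : {pred G}) (n : nat) : Prop :=
  (left_cosets H #= `I_n)%card.

Definition avoiding_index (G : groupType) (g : G) (n : nat) : Prop :=
  exists H : {pred G}, [/\ group_closed H, has_index H n & g \notin H].

(* The value 0 is taken only when every subgroup of finite index contains [g];
   by [min_indexP] below, this does not happen for a nontrivial element of a
   free group. *)
Definition min_index (G : groupType) (g : G) : nat :=
  xget 0 [set n | avoiding_index g n /\
                  forall m, avoiding_index g m -> n <= m].

Definition nontrivial_ball (k N : nat) : set (free_group k) :=
  [set g | g != 1 /\ word_length g <= N].

Arguments nontrivial_ball : clear implicits.

Lemma finite_nontrivial_ball k N : finite_set (nontrivial_ball k N).
Proof.
pose f (w : N.-bseq (letter k)) : free_group k := insubd (fg_one k) (bseqval w).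
apply: (@sub_finite_set _ _ (f @` setT)); last exact/finite_image/finite_finset.
move=> g [_ gN]; exists (insub_bseq N (word g)) => //.
apply: val_inj; rewrite val_insubd /= /insub_bseq insubdK ?word_reduced//.
Qed.

(* A partial injection of a finite type extends to a permutation. *)
Lemma partial_inj_perm (T : finType) (e : rel T) :
  (forall x y z, e x y -> e x z -> y = z) ->
  (forall x y z, e x z -> e y z -> x = y) ->
  exists s : {perm T}, forall x y, e x y -> s x = y.
Proof.
move=> e_fun e_inj.
pose A := [set x | [exists y, e x y]]%SET.
pose B := [set y | [exists x, e x y]]%SET.
pose f x := odflt x [pick y | e x y].
have fE x y : e x y -> f x = y.
  by rewrite /f => exy; case: pickP => [z /e_fun/(_ exy)|/(_ y)] //=; rewrite exy.
have fA : (f @: A = B)%SET.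
  apply/setP=> y; rewrite inE; apply/imsetP/existsP => [[x + ->]|[x exy]].
    by rewrite inE => /existsP[z exz]; exists x; rewrite (fE _ _ exz).
  by exists x; rewrite ?inE ?(fE _ _ exy)//; apply/existsP; exists y.
have f_inj : {in A &, injective f}.
  move=> x y; rewrite !inE => /existsP[x' ex] /existsP[y' ey].
  by rewrite (fE _ _ ex) (fE _ _ ey) => eq_xy; move: ex; rewrite eq_xy => /e_inj/(_ ey).
have cAB : #|~: A| = #|~: B|.
  by apply/eqP; rewrite -(eqn_add2l #|A|) cardsC -(card_in_imset f_inj) fA cardsC.
pose g x := nth x (enum (~: B)) (index x (enum (~: A))).
have gP x : x \notin A -> index x (enum (~: A)) < size (enum (~: B)).
  by move=> nAx; rewrite -cardE -cAB cardE index_mem mem_enum inE.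
have gB x : x \notin A -> g x \notin B.
  by move=> nAx; have := mem_nth x (gP x nAx); rewrite mem_enum inE.
have fB x : x \in A -> f x \in B by move=> Ax; rewrite -fA imset_f.
pose h x := if x \in A then f x else g x.
have h_inj : injective h.
  move=> x y; rewrite /h; case: ifPn => Ax; case: ifPn => Ay.
  - exact: f_inj.
  - by move=> E; have := gB y Ay; rewrite -E fB.
  - by move=> E; have := gB x Ax; rewrite E fB.
  rewrite /g (set_nth_default y) ?gP// => /eqP.
  rewrite nth_uniq ?gP ?enum_uniq// => /eqP.
  by apply: (index_inj x); rewrite mem_enum finset.in_setC.
exists (perm h_inj) => x y exy; rewrite permE /h inE.
by case: existsP => [_|[]]; [apply: fE | exists y].
Qed.

(* The letters of [g], read from left to right, prescribe partial injections of
   {0, ..., n}, n being the length of [g]; extending them to permutations yields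
   an action for which [g] does not fix 0. *)
Lemma free_group_residually_finite k (g : free_group k) :
  g != 1 -> exists n, avoiding_index g n.
Proof.
move=> g1; set n := size (word g).
have n_gt0 : 0 < n.
  by rewrite lt0n size_eq0; apply: contraNneq g1 => g0; apply/eqP/val_inj.
pose e i : rel 'I_n.+1 := fun p q =>
  (q == p.+1 :> nat) && (onth (word g) p == Some (i, false))
  || (p == q.+1 :> nat) && (onth (word g) q == Some (i, true)).
have gred p x y : onth (word g) p = Some x -> onth (word g) p.+1 = Some y ->
    y != letter_inv x.
  have := word_reduced g; rewrite /reduced; elim: (word g) p => [|z w IHw] [|p] //=.
    by case: w {IHw} => //= z' w /andP[+ _] [<-] [<-].
  by move=> zw; apply: IHw; apply: path_sorted zw.
have e_fun i p q r : e i p q -> e i p r -> q = r.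
  move=> /orP[]/andP[/eqP E1 /eqP F1] /orP[]/andP[/eqP E2 /eqP F2];
    apply: val_inj => /=.
  - by rewrite E1 E2.
  - by move: F1; rewrite E2 => F1; have := gred _ _ _ F2 F1; rewrite eqxx.
  - by move: F2; rewrite E1 => F2; have := gred _ _ _ F1 F2; rewrite eqxx.
  by move: E1; rewrite E2 => -[].
have e_inj i p q r : e i p r -> e i q r -> p = q.
  move=> /orP[]/andP[/eqP E1 /eqP F1] /orP[]/andP[/eqP E2 /eqP F2];
    apply: val_inj => /=.
  - by move: E1; rewrite E2 => -[].
  - by move: F2; rewrite E1 => F2; have := gred _ _ _ F1 F2; rewrite eqxx.
  - by move: F1; rewrite E2 => F1; have := gred _ _ _ F2 F1; rewrite eqxx.
  by rewrite E1 E2.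
pose s i := projT1 (cid (partial_inj_perm (e_fun i) (e_inj i))).
have sP i p q : e i p q -> s i p = q by rewrite /s; case: cid => /= t; apply.
have letterP (p q : 'I_n.+1) x : q = p.+1 :> nat ->
    onth (word g) p = Some x -> lift_letter s x p = q.
  case: x => i [] qp gp; rewrite /lift_letter /=.
    by apply: (@perm_inj _ (s i)); rewrite permKV; apply/esym/sP;
       rewrite /e qp gp !eqxx orbT.
  by apply: sP; rewrite /e qp gp !eqxx.
pose phi := fg_lift s.
have phig : phi g ord0 = ord_max.
  suff take_phi m (mn : m < n.+1) :
      (\prod_(x <- take m (word g)) lift_letter s x) ord0 = Ordinal mn.
    have := take_phi n (ltnSn n); rewrite take_size => E.
    by rewrite /phi /fg_lift E; apply: val_inj.
  elim: m mn => [|m IHm] mn; first by rewrite take0 big_nil perm1; apply: val_inj.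
  have [x gm] : exists x, onth (word g) m = Some x.
    have := onthTE (word g) m; rewrite -/n (mn : m < n).
    by case: onth => // x _; exists x.
  have -> : take m.+1 (word g) = rcons (take m (word g)) x.
    by rewrite (take_nth x) // (@onth_nth _ x _ _ _ gm).
  rewrite -cats1 big_cat big_seq1 permM (IHm (ltnW mn)).
  exact: letterP.
pose H : {pred free_group k} := fun h => phi h ord0 == ord0.
have HP x h : (x^-1 * h \in H) = (phi x^-1 ord0 == phi h^-1 ord0).
  rewrite unfold_in /H /phi fg_liftM permM fg_liftV (fg_liftV _ h).
  by rewrite -(inj_eq (@perm_inj _ (fg_lift s h)^-1)) permK.
have Hgrp : group_closed H.
  split=> [|x y]; first by rewrite unfold_in /phi fg_lift1 perm1.
  rewrite !unfold_in /H /phi => /eqP x0 /eqP y0.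
  by rewrite fg_liftM permM x0 fg_liftV -{1}y0 permK.
have cosetE x : [set x * h | h in [set` H]] =
    [set y | phi y^-1 ord0 = phi x^-1 ord0].
  apply/seteqP; split=> [_ [h /= Hh <-]|y /= E].
    by apply/esym/eqP; rewrite -HP mulKg.
  by exists (x^-1 * y); rewrite ?mulVKg//= HP E.
have [m mP] : finite_set (left_cosets H).
  apply: (@sub_finite_set _ _
    ((fun p => [set y | phi y^-1 ord0 = p]) @` [set: 'I_n.+1])); last first.
    exact/finite_image/finite_finset.
  by move=> _ [x _ <-]; rewrite cosetE; exists (phi x^-1 ord0).
exists m, H; split=> //; rewrite unfold_in /H phig -val_eqE /=.
by rewrite -lt0n.
Qed.

Lemma min_indexP k (g : free_group k) : g != 1 ->
  avoiding_index g (min_index g) /\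
  forall m, avoiding_index g m -> min_index g <= m.
Proof.
move=> /free_group_residually_finite ex_n; rewrite /min_index.
case: xgetP => [n -> //|] none; exfalso.
have ex_b : exists n, `[< avoiding_index g n >].
  by case: ex_n => n ?; exists n; apply/asboolP.
have := none (ex_minn ex_b); apply; case: ex_minnP => n /asboolP gn min_n.
by split=> // m /asboolP; apply: min_n.
Qed.

(* Main.v *)
(* The mean of [i] is the sum over [m] of the proportion of [g] with [i g > m],
   that is, of [g] in the intersection of all subgroups of index at most [m].

   Let [k > 1] and [q = 2k - 1]. If that intersection contains no nontrivial
   word of length at most [2l], then two of its elements of equal length with the
   same word after the first [l] letters coincide, so its proportion in each
   sphere is at most [q^-l]. Since [i g <= |g| + 1], one may take
   [l = (m - 1) / 2], and the sum over [m] is geometric. For [m = 2] the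
   proportion is at most [2 / q], as all exponent sums are even. This suffices for
   [k > 2]. For [k = 2] one also uses that words of length at most 4 have [i <= 3]
   and that [i = 2] on words of odd length.

   For [k = 1], [i g > m] means that [lcm(1, ..., m)] divides the exponent. *)
Require Import Defs.
From mathcomp Require Import all_boot all_order all_fingroup all_algebra.
From mathcomp Require Import finmap all_classical all_reals.
From mathcomp Require Import zify ring lra.
Set Implicit Arguments.
Unset Strict Implicit.
Unset Printing Implicit Defensive.
Import Order.TTheory GRing.Theory Num.Theory.

(** * Upper bounds on the index from actions on finite sets *)

Lemma min_index_le k (g : free_group k) n :
  avoiding_index g n -> min_index g <= n.
Proof.
move=> gn; have g1 : g != 1%g.
  by case: gn => H [[H1 _] _]; apply: contraNneq => ->.
by have [_] := min_indexP g1; apply.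
Qed.

(** Letters act from left to right, as in products of permutations, where [s * t] applies [s]
    first. *)
Definition walk k (T : Type) (F : letter k -> T -> T) (p : T) (w : seq (letter k)) : T :=
  foldl (fun q x => F x q) p w.

(** The stabiliser of [p] avoids [g], and its left cosets inject into [T]: the coset of [x] is
    determined by the image of [p] under [x^-1], since permutations act on the right. *)
Lemma min_index_le_walk k (T : finType) (F : letter k -> T -> T) (p : T)
    (g : free_group k) :
  (forall x, cancel (F x) (F (letter_inv x))) -> walk F p g != p ->
  min_index g <= #|T|.
Proof.
move=> FK gp.
pose s i := perm (can_inj (FK (i, false))).
have sE x q : lift_letter s x q = F x q.
  case: x => i [] /=; rewrite /lift_letter /=; last by rewrite permE.
  by apply: (@perm_inj _ (s i)); rewrite permKV permE -{1}[q](FK (i, true)).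
pose phi := fg_lift s.
have phiE h : phi h p = walk F p h.
  rewrite /phi /fg_lift /walk; elim/last_ind: (word h) => [|w x IHw].
    by rewrite big_nil perm1.
  by rewrite -cats1 big_cat big_seq1 permM foldl_cat IHw /= sE.
have phiV h : phi h^-1%g = (phi h)^-1%g by apply: fg_liftV.
have phiM h h' : phi (h * h')%g = (phi h * phi h')%g by apply: fg_liftM.
pose H : {pred free_group k} := fun h => phi h p == p.
have cosetE x : ([set x * h | h in [set` H]] =
    [set y | phi y^-1 p = phi x^-1 p])%g%classic.
  apply/seteqP; split=> [_ [h /= /eqP Hh <-]|y /= E].
    by rewrite phiV phiM invMg permM -{1}Hh permK phiV.
  exists (x^-1 * y)%g; rewrite ?mulVKg //=; apply/eqP.
  by rewrite phiM permM -E phiV permKV.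
pose C q := [set y | phi y^-1%g p = q]%classic.
have subC : (left_cosets H `<=` (C \o enum_val) @` [set: 'I_#|T|])%classic.
  move=> _ [x _ <-]; rewrite cosetE; exists (enum_rank (phi x^-1%g p)) => //=.
  by rewrite enum_rankK.
have [n Hn] : finite_set (left_cosets H).
  by apply: (sub_finite_set subC); apply: finite_image; apply: finite_finset.
have nT : n <= #|T|.
  have /card_eqPle[_ nH] := Hn; have /card_eqPle[_ TI] := @card_II #|T|.
  rewrite -card_le_II; apply: card_le_trans nH _.
  apply: card_le_trans (subset_card_le subC) _.
  exact: card_le_trans (card_image_le _ _) TI.
apply: leq_trans nT; apply: min_index_le; exists H; split=> //; last first.
  by rewrite unfold_in /H phiE.
split=> [|x y]; first by rewrite unfold_in /H /phi fg_lift1 perm1.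
rewrite !unfold_in /H => /eqP xp /eqP yp.
by rewrite phiM permM xp phiV -{1}yp permK.
Qed.


(* The letters of [g], read from left to right, prescribe a path [0, ..., n] in a
   permutation action on [n + 1] points; reducedness is what makes the prescribed
   partial maps well defined and injective. *)
Lemma min_index_le_length k (g : free_group k) :
  g != 1%g -> min_index g <= (word_length g).+1.
Proof.
rewrite /word_length -(inj_eq val_inj) /= => g1.
have [x0 [u gE]] : exists x0 u, word g = x0 :: u.
  by case: (word g) g1 => // x u _; exists x, u.
have := word_reduced g; rewrite gE => /(pathP x0) red_g.
set w := x0 :: u in gE red_g *; set n := size w.
have nE : n = (size u).+1 by [].
have noback p i b : p < size u -> nth x0 w p = (i, b) -> nth x0 w p.+1 = (i, ~~ b) -> False.
  by move=> pu E1 E2; have := red_g p pu; rewrite E1 -[nth x0 u p]/(nth x0 w p.+1) E2 eqxx.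
(* Both end points of an edge are at most [n], so the default of [nth] is never read. A letter
   [(i, true)] contributes a reversed edge, since it acts by the inverse of [s i]. *)
pose e i : rel 'I_n.+1 := fun p q =>
  (q == p.+1 :> nat) && (nth x0 w p == (i, false))
  || (p == q.+1 :> nat) && (nth x0 w q == (i, true)).
have e_fun i p q r : e i p q -> e i p r -> q = r.
  have := ltn_ord q; have := ltn_ord r=> rn qn.
  move=> /orP[]/andP[/eqP E1 /eqP F1] /orP[]/andP[/eqP E2 /eqP F2]; apply: val_inj => /=.
  - by rewrite E1 E2.
  - by case: (@noback r i true _ F2); [lia | rewrite -E2 F1].
  - by case: (@noback q i true _ F1); [lia | rewrite -E1 F2].
  - lia.
have e_inj i p q r : e i p r -> e i q r -> p = q.
  have := ltn_ord p; have := ltn_ord q=> pn qn.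
  move=> /orP[]/andP[/eqP E1 /eqP F1] /orP[]/andP[/eqP E2 /eqP F2]; apply: val_inj => /=.
  - lia.
  - by case: (@noback p i false _ F1); [lia | rewrite -E1 F2].
  - by case: (@noback q i false _ F2); [lia | rewrite -E2 F1].
  - by rewrite E1 E2.
pose s i := projT1 (cid (partial_inj_perm (e_fun i) (e_inj i))).
have sP i p q : e i p q -> s i p = q by rewrite /s; case: cid => /= t; apply.
pose F x (p : 'I_n.+1) := lift_letter s x p.
have FK x : cancel (F x) (F (letter_inv x)).
  by move=> p; rewrite /F lift_letterV permK.
have Fw m : m < n -> F (nth x0 w m) (inord m) = inord m.+1.
  move=> mn; have mE : (inord m : 'I_n.+1) = m :> nat by rewrite inordK // ltnW.
  have m1E : (inord m.+1 : 'I_n.+1) = m.+1 :> nat by rewrite inordK.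
  rewrite /F /lift_letter; case Ex: (nth x0 w m) => [i []] /=.
    by apply: (@perm_inj _ (s i)); rewrite permKV; apply/esym/sP; rewrite /e mE m1E Ex !eqxx orbT.
  by apply: sP; rewrite /e mE m1E Ex !eqxx.
have take_w m : m <= n -> walk F ord0 (take m w) = inord m.
  elim: m => [_|m IHm mn]; first by rewrite take0; apply: val_inj; rewrite /= inordK.
  by rewrite (take_nth x0) // -cats1 /walk foldl_cat [foldl _ _ (take m w)]IHm ?(ltnW mn) //= Fw.
rewrite -[X in _ <= X]card_ord.
apply: (min_index_le_walk FK (p := ord0)).
by rewrite gE -(take_size w) take_w // -val_eqE /= inordK.
Qed.

(** * Reduced words and parity of exponents *)

(** A non-reduced sequence stands for the identity, whose index is 0 because no subgroup avoids
    it. *)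
Definition word_index k (w : seq (letter k)) : nat := min_index (insubd (fg_one k) w).

Lemma word_insubd k (w : seq (letter k)) : reduced w -> insubd (fg_one k) w = w :> seq _.
Proof. exact: insubdK. Qed.

Lemma word_index_le_size k (w : seq (letter k)) :
  reduced w -> w != [::] -> word_index w <= (size w).+1.
Proof.
move=> rw w0; rewrite -{2}(word_insubd rw); apply: min_index_le_length.
by apply: contra_neq w0 => /(congr1 val); rewrite /= word_insubd.
Qed.

Lemma word_index_le_walk k (T : finType) (F : letter k -> T -> T) (p : T) w :
  (forall x, cancel (F x) (F (letter_inv x))) -> reduced w -> walk F p w != p ->
  word_index w <= #|T|.
Proof.
by move=> FK rw; rewrite -{1}(word_insubd rw); apply: min_index_le_walk.
Qed.

(** The letters over [i] swap the two booleans and all others fix them: this is the action through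
    the exponent parity of [i]. *)
Lemma word_index_parity k (i : 'I_k) w :
  reduced w -> odd (count (fun x => x.1 == i) w) -> word_index w <= 2.
Proof.
move=> rw iw; rewrite -card_bool.
pose F (x : letter k) (p : bool) := p (+) (x.1 == i).
have FE p : walk F p w = p (+) odd (count (fun x => x.1 == i) w).
  elim: w p {rw iw} => [|x w IHw] p; first by rewrite addbF.
  by rewrite /= IHw oddD oddb addbA.
apply: (word_index_le_walk (F := F) (p := false)) => //.
  by move=> x p; rewrite /F /= -addbA addbb addbF.
by rewrite FE iw.
Qed.

Lemma sum_count_letters k (w : seq (letter k)) :
  \sum_(i < k) count (fun x => x.1 == i) w = size w.
Proof.
elim: w => [|x w IHw] /=; first by rewrite big1.
rewrite big_split /= IHw -add1n; congr (_ + _).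
by rewrite (bigD1 x.1) //= eqxx big1 // => i /negPf; rewrite eq_sym => ->.
Qed.

Lemma word_index_odd_size k (w : seq (letter k)) :
  reduced w -> odd (size w) -> word_index w <= 2.
Proof.
move=> rw ow.
have [/existsP[i]|/existsPn even_w] := boolP [exists i, odd (count (fun x : letter k => x.1 == i) w)].
  exact: word_index_parity.
move: ow; rewrite -sum_count_letters.
suff -> : odd (\sum_(i < k) count (fun x => x.1 == i) w) = false by [].
by elim/big_ind: _ => // [a b|i _]; [rewrite oddD => -> -> | apply: negPf].
Qed.

(** * The intersection of all subgroups of small index *)

(** Both elements lie in every subgroup of index at most [m], hence so does the quotient. The
    identity must be excluded because its index is 0. *)
Lemma min_index_coset k (g h : free_group k) m :
  m < min_index g -> m < min_index h -> (g * h^-1)%g != 1%g ->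
  m < min_index (g * h^-1)%g.
Proof.
move=> mg mh /min_indexP[[H [Hgrp Hn gh]] _]; rewrite ltnNge; apply/negP => nm.
have inH f : m < min_index f -> f \in H.
  move=> mf; apply: contraLR mf => fH; rewrite -leqNgt.
  by apply: leq_trans nm; apply: min_index_le; exists H.
by move/negP: gh; apply; case: Hgrp => _; apply; apply: inH.
Qed.

(* If [v u] and [v' u] both lie in the intersection of all subgroups of index
   at most [m], then so does [v v'^-1], which is too short for that. *)
Lemma word_index_prefix_uniq k m l (u v v' : seq (letter k)) :
  (forall w : seq (letter k), reduced w -> w != [::] -> size w <= l.*2 -> word_index w <= m) ->
  size v = l -> size v' = l -> reduced (v ++ u) -> reduced (v' ++ u) ->
  m < word_index (v ++ u) -> m < word_index (v' ++ u) -> v = v'.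
Proof.
move=> short vl v'l rvu rv'u mvu mv'u.
have [rv _] : reduced v /\ reduced u by move: rvu; rewrite /reduced => /cat_sorted2[].
have [rv' ru] : reduced v' /\ reduced u by move: rv'u; rewrite /reduced => /cat_sorted2[].
pose G w := insubd (fg_one k) w.
have GM a b : reduced (a ++ b) -> reduced a -> reduced b -> G (a ++ b) = (G a * G b)%g.
  move=> rab ra rb; apply: val_inj; rewrite /= !word_insubd //.
  by rewrite -[LHS]push_words0 // /push_word foldr_cat -/(push_word b _) push_words0.
have gE : (G v * (G v')^-1 = G (v ++ u) * (G (v' ++ u))^-1)%g.
  by rewrite !GM // invMg mulgA mulgK.
have [g1|g1] := eqVneq (G v * (G v')^-1)%g 1%g.
  by rewrite -(word_insubd rv) -(word_insubd rv'); congr word; apply: (mulIg (G v')^-1%g); rewrite mulgV g1.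
have := min_index_coset mvu mv'u; rewrite -gE => /(_ g1); rewrite ltnNge => /negP[].
set g := (_ * _)%g in g1 *; have -> : g = G (word g) by apply/val_inj/esym/word_insubd/word_reduced.
apply: short; first exact: word_reduced.
  by rewrite -(inj_eq val_inj) in g1.
rewrite (leq_trans (size_push_word _ _)) //= /word_inv size_rev size_map !word_insubd //.
by rewrite vl v'l addnn.
Qed.

(** * Enumeration of reduced words *)

Lemma reduced_tail k (x : letter k) w : reduced (x :: w) -> reduced w.
Proof. exact: path_sorted. Qed.

Definition extensions k (w : seq (letter k)) : seq (letter k) :=
  [seq x <- enum {: letter k} | reduced (x :: w)].

Fixpoint reduced_words k n : seq (seq (letter k)) :=
  if n is n'.+1 then [seq x :: w | w <- reduced_words k n', x <- extensions w]
  else [:: [::]].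

Lemma mem_reduced_words k n w : (w \in reduced_words k n) = reduced w && (size w == n).
Proof.
elim: n w => [|n IHn] w /=; first by rewrite inE; case: w => [|x w]; rewrite ?andbF.
apply/allpairsPdep/idP => [[v [x [+ + ->]]]|].
  by rewrite IHn mem_filter /= eqSS => /andP[_ ->] /andP[-> _].
case: w => [|x w] /andP[rxw]; first by [].
rewrite /= eqSS => wn; exists w, x; split=> //; last by rewrite mem_filter rxw mem_enum.
by rewrite IHn wn (reduced_tail rxw).
Qed.

Lemma reduced_words_uniq k n : uniq (reduced_words k n).
Proof.
elim: n => //= n IHn; apply: allpairs_uniq_dep => //.
  by move=> w _; rewrite filter_uniq ?enum_uniq.
by move=> [w x] [v y] _ _ /= [-> ->].
Qed.

Lemma size_reduced_words1 k : size (reduced_words k 1) = k.*2.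
Proof.
rewrite /= size_cat size_map addn0 /extensions (eq_filter (a2 := predT)) //.
by rewrite filter_predT -cardE card_prod card_ord card_bool muln2.
Qed.

(** Every letter except the inverse of the first one can be prepended. The empty word admits all
    [2k] letters, so the recursion starts at length 1. *)
Lemma size_reduced_wordsS k n :
  size (reduced_words k n.+2) = k.*2.-1 * size (reduced_words k n.+1).
Proof.
rewrite [reduced_words k n.+2]/= size_allpairs_dep.
set t := map _ _; have /all_pred1P -> : all (pred1 k.*2.-1) t.
  apply/allP => m /mapP[w + ->].
  rewrite -/(reduced_words k n.+1) mem_reduced_words; case: w => // y w /andP[ryw _]; apply/eqP.
  rewrite size_filter (eq_count (a2 := predC1 (letter_inv y))) => [|x] /=; last first.
    rewrite /reduced /= in ryw *; rewrite ryw andbT.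
    by rewrite -(inj_eq (can_inj (@letter_invK k))) letter_invK eq_sym.
  have := count_predC (pred1 (letter_inv y)) (enum {: letter k}).
  rewrite count_uniq_mem ?enum_uniq // mem_enum -cardE.
  by rewrite card_prod card_ord card_bool muln2 => <-.
by rewrite sumn_nseq size_map mulnC.
Qed.

Arguments reduced_words : simpl never.

Lemma size_reduced_words k n : size (reduced_words k n.+1) = k.*2 * k.*2.-1 ^ n.
Proof.
by elim: n => [|n IHn]; rewrite ?size_reduced_words1 ?muln1 // size_reduced_wordsS IHn mulnCA expnS.
Qed.

(** * Proportion of words of large index in a sphere *)

(** For [n > 0], the part of the sphere inside the intersection of all subgroups of index at most
    [m]. *)
Definition bad_words k m n := [seq w <- reduced_words k n | m < word_index w].

Lemma size_bad_words_le k m n : size (bad_words k m n) <= size (reduced_words k n).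
Proof. by rewrite size_filter count_size. Qed.

Lemma bad_words_short k m l n :
  (forall w : seq (letter k), reduced w -> w != [::] -> size w <= l -> word_index w <= m) ->
  0 < n <= l -> size (bad_words k m n) = 0.
Proof.
move=> short /andP[n0 nl]; rewrite size_filter; apply/eqP; rewrite -leqn0 leqNgt -has_count.
apply/hasPn => w; rewrite mem_reduced_words => /andP[rw /eqP wn].
by rewrite -leqNgt short ?wn // -size_eq0 wn -lt0n.
Qed.

(** Deleting the first [l] letters is injective on bad words, and for [n <= 2l] there are none. *)
Lemma bad_words_girth k m l n :
  (forall w : seq (letter k), reduced w -> w != [::] -> size w <= l.*2 -> word_index w <= m) ->
  0 < n -> k.*2.-1 ^ l * size (bad_words k m n) <= size (reduced_words k n).
Proof.
move=> short n0; case: (leqP n l.*2) => [nl|].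
  by rewrite (bad_words_short short) ?muln0 // n0.
case: n {n0} => // n nl.
(* At least one letter survives the cut, so [size_reduced_words] also counts the tails. *)
have ln : l <= n by lia.
have -> : size (reduced_words k n.+1) =
    k.*2.-1 ^ l * size (reduced_words k (n - l).+1).
  by rewrite !size_reduced_words mulnCA -expnD subnKC.
rewrite leq_mul2l; apply/orP; right.
rewrite -(size_map (drop l)); apply: uniq_leq_size.
  rewrite map_inj_in_uniq ?filter_uniq ?reduced_words_uniq // => w w'.
  rewrite !mem_filter !mem_reduced_words => /and3P[mw rw /eqP wn] /and3P[mw' rw' /eqP w'n] E.
  rewrite -[LHS](cat_take_drop l) -[RHS](cat_take_drop l) E; congr (_ ++ _).
  apply: (word_index_prefix_uniq (u := drop l w) short);
    rewrite ?size_take_min ?wn ?w'n; try lia; rewrite ?cat_take_drop // E cat_take_drop //.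
move=> _ /mapP[w + ->]; rewrite mem_filter !mem_reduced_words => /and3P[_ rw /eqP wn].
by rewrite /reduced drop_sorted // size_drop wn subSn // eqxx.
Qed.

Lemma bad_words_odd k n : odd n -> size (bad_words k 2 n) = 0.
Proof.
move=> n_odd; rewrite size_filter; apply/eqP; rewrite -leqn0 leqNgt -has_count.
apply/hasPn => w; rewrite mem_reduced_words => /andP[rw /eqP wn].
by rewrite -leqNgt word_index_odd_size // wn.
Qed.

(* All exponent sums of [x w] being even, the exponent parities of [w] determine
   [x] up to inversion. *)
Lemma bad_words2 k n : 0 < n ->
  k.*2.-1 * size (bad_words k 2 n) <= 2 * size (reduced_words k n).
Proof.
case: n => // -[|n] _; first by rewrite (bad_words_odd k (n := 1)) ?muln0.
rewrite size_reduced_wordsS mulnCA leq_mul2l; apply/orP; right.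
(* The first letter is dropped but its sign bit kept; the default [false] serves only the empty
   word, which does not occur. *)
pose f (w : seq (letter k)) := (behead w, (head false [seq x.2 | x <- w])).
have -> : 2 * size (reduced_words k n.+1) =
    size [seq (v, b) | v <- reduced_words k n.+1, b <- [:: true; false]].
  by rewrite size_allpairs mulnC.
rewrite -(size_map f).
have even_w w i : w \in bad_words k 2 n.+2 -> odd (count (fun x => x.1 == i) w) = false.
  rewrite mem_filter mem_reduced_words => /and3P[mw rw _].
  by apply: contraTF mw => odd_w; rewrite -leqNgt (word_index_parity rw odd_w).
apply: uniq_leq_size.
  rewrite map_inj_in_uniq ?filter_uniq ?reduced_words_uniq // => w w' bw bw'.
  case: w bw => [|x w]; first by rewrite mem_filter mem_reduced_words /= andbF.
  case: w' bw' => [|x' w']; first by rewrite mem_filter mem_reduced_words /= andbF.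
  move=> bw' bw [E E2]; rewrite -E {w' E} in bw' *; congr (_ :: _).
  have := even_w _ x.1 bw; have := even_w _ x.1 bw'; rewrite /= !oddD eqxx /= !oddb.
  case: (x'.1 =P x.1) => [E1 _ _|_ /= -> //].
  by case: x x' E1 E2 {bw bw'} => a b [a' b'] /= -> ->.
move=> _ /mapP[w + ->]; rewrite mem_filter mem_reduced_words => /and3P[_ rw /eqP wn].
apply/allpairsP; exists (f w); split=> //; last by rewrite !inE; case: (f w).2.
rewrite mem_reduced_words /= size_behead wn eqxx andbT.
by case: w rw {wn} => // x w /reduced_tail.
Qed.

(** Layer-cake summation; thresholds [m > n] contribute nothing, the index being at most [n + 1]. *)
Lemma sum_word_index k n : 0 < n ->
  \sum_(w <- reduced_words k n) word_index w = \sum_(m < n.+1) size (bad_words k m n).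
Proof.
move=> n0; under [RHS]eq_bigr do rewrite size_filter -sum1_count big_mkcond.
rewrite exchange_big; apply: eq_big_seq => w; rewrite mem_reduced_words => /andP[rw /eqP wn].
have le_n : word_index w <= n.+1.
  by rewrite -wn word_index_le_size // -size_eq0 wn -lt0n.
by rewrite -big_mkcond /= (big_ord_narrow le_n) sum1_card card_ord.
Qed.

(** * Rank 2: words of length at most 4 *)

(* The points of [option bool] are permuted by a 3-cycle (code 1) and by two
   transpositions (codes 2 and 3). *)
Definition perm3 (c : nat) (b : bool) (p : option bool) : option bool :=
  match c, b, p with
  | 1, false, None => Some false
  | 1, false, Some false => Some true
  | 1, false, Some true => None
  | 1, true, None => Some true
  | 1, true, Some false => None
  | 1, true, Some true => Some false
  | 2, _, None => Some false
  | 2, _, Some false => None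
  | 3, _, Some q => Some (~~ q)
  | _, _, _ => p
  end.

Definition act3 (ca cb : nat) (x : letter 2) : option bool -> option bool :=
  perm3 (if x.1 == ord0 then ca else cb) x.2.

Lemma act3K ca cb x : cancel (act3 ca cb x) (act3 ca cb (letter_inv x)).
Proof.
rewrite /act3 /letter_inv /=; case: ifP => _.
  by move: ca => [|[|[|[|c]]]]; case: x.2 => -[[]|].
by move: cb => [|[|[|[|c]]]]; case: x.2 => -[[]|].
Qed.

Definition letters2 : seq (letter 2) :=
  [seq (i, b) | i <- [:: @Ordinal 2 0 isT; @Ordinal 2 1 isT], b <- [:: true; false]].

Fixpoint words2 n : seq (seq (letter 2)) :=
  if n is n'.+1 then [seq x :: w | x <- letters2, w <- words2 n'] else [:: [::]].

Lemma mem_words2 w : w \in words2 (size w).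
Proof.
elim: w => // x w IHw; apply/allpairsP; exists (x, w); split=> //.
by case: x => -[[|[|i]] //= Hi] [] //; rewrite /letters2 /= !inE -!pair_eqE /= -!val_eqE.
Qed.

(** The first four tests leave only words whose exponent sums are divisible by 6. Among nonempty
    reduced words of length at most 4 these are commutators of two letters, which act as a 3-cycle
    in the last test. *)
Definition moved3 (w : seq (letter 2)) : bool :=
  has (fun c => walk (act3 c.1 c.2) None w != None)
    [:: (2, 0); (0, 2); (1, 0); (0, 1); (2, 3)].

Lemma word_index2_le3 (w : seq (letter 2)) :
  reduced w -> w != [::] -> size w <= 4 -> word_index w <= 3.
Proof.
move=> rw w0 w4.
(* An exhaustive check of the 4 + 16 + 64 + 256 nonempty sequences of length at most 4. *)
have : all (all (fun w => reduced w ==> moved3 w)) [seq words2 n | n <- [:: 1; 2; 3; 4]].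
  by vm_compute.
move=> /allP/(_ (words2 (size w))) => H.
have {}H : all (fun w => reduced w ==> moved3 w) (words2 (size w)).
  by apply: H; apply: map_f; move: w4 w0; rewrite -size_eq0; case: (size w) => [|[|[|[|[|]]]]].
have := allP H w (mem_words2 w); rewrite rw => /hasP[c _ cw].
have := word_index_le_walk (@act3K c.1 c.2) rw cw.
by rewrite card_option card_bool.
Qed.

(** * Rank 1: powers of the generator *)

Lemma reduced1_nseq (x : letter 1) w : reduced (x :: w) -> w = nseq (size w) x.
Proof.
elim: w x => // y w IHw x rxy; have yx : y = x.
  move: rxy; rewrite /reduced /= => /andP[+ _]; case: x y => [i b] [j c].
  by rewrite (ord1 i) (ord1 j); case: b c => -[].
by rewrite yx in rxy *; rewrite [in LHS](IHw x (reduced_tail rxy)).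
Qed.

(** The generator rotates [Z/d] by 1, so a word of length [n] moves 0 to [n] or [-n], which is 0
    only when [d] divides [n]. *)
Lemma word_index1_dvd (w : seq (letter 1)) m d :
  reduced w -> m < word_index w -> 0 < d <= m -> d %| size w.
Proof.
case: w => // x w rw mw /andP[]; case: d => [|[|d]] // _ dm; apply: contraTT mw => ndvd.
rewrite -leqNgt (leq_trans _ dm) // -[d.+2]card_ord.
pose F (y : letter 1) (p : 'I_d.+2) : 'I_d.+2 := (if y.2 then p - 1 else p + 1)%R.
apply: (word_index_le_walk (F := F) (p := 0%R)) => //.
  by case=> i [] p; rewrite /F /= ?addrK ?subrK.
rewrite [x :: w](_ : _ = nseq (size w).+1 x); last by rewrite /= -reduced1_nseq.
have walkE n : walk F 0%R (nseq n x) = (if x.2 then - n%:R else n%:R)%R.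
  rewrite /walk; elim: n => [|n IHn]; first by case: ifP; rewrite ?oppr0.
  have -> : nseq n.+1 x = nseq n x ++ [:: x] by rewrite -[n.+1]addn1 nseqD.
  by rewrite foldl_cat IHn /= /F mulrSr; case: x.2; rewrite ?opprD.
rewrite walkE; have nz : ((size w).+1%:R : 'I_d.+2)%R != 0%R.
  apply: contraNneq ndvd => E0; rewrite /dvdn -(@val_Zp_nat d.+2 isT).
  by apply/eqP; apply: (congr1 (@nat_of_ord _) E0).
by case: ifP => _ //; rewrite oppr_eq0.
Qed.

Local Open Scope ring_scope.

(** * Summation over the thresholds *)

Lemma sum_word_index_le (R : numDomainType) k n (c : nat -> R) : (0 < n)%N ->
  (forall m, (size (bad_words k m n))%:R <= c m * (size (reduced_words k n))%:R) ->
  (\sum_(w <- reduced_words k n) word_index w)%N%:R <=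
    (\sum_(m < n.+1) c m) * (size (reduced_words k n))%:R.
Proof.
by move=> n0 bad_c; rewrite sum_word_index // natr_sum mulr_suml ler_sum.
Qed.

Lemma geometric_halves (R : realFieldType) (x : R) M : 0 <= x < 1 ->
  \sum_(m < M) x ^+ m./2 <= 2 / (1 - x).
Proof.
move=> /andP[x0 x1]; have y0 : 0 < 1 - x by rewrite subr_gt0.
(* Peeling off the two leading ones leaves [x] times the sum with two terms fewer, hence an
   induction on pairs of consecutive [M]. *)
have [] // : \sum_(m < M) x ^+ m./2 <= 2 / (1 - x) /\
  \sum_(m < M.+1) x ^+ m./2 <= 2 / (1 - x).
elim: M => [|M [IH1 IH2]].
  rewrite big_ord1 big_ord0 expr0; split; first by rewrite divr_ge0 ?ltW.
  by rewrite ler_pdivlMr //; lra.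
split=> //; rewrite 2!big_ord_recl /=.
under eq_bigr do rewrite /bump /= exprS; rewrite -mulr_sumr !expr0.
have -> : 2 / (1 - x) = 1 + (1 + x * (2 / (1 - x))) by field; rewrite lt0r_neq0.
by rewrite !lerD2l ler_wpM2l.
Qed.

Lemma ler_sum_ord_addr (R : numDomainType) (c : nat -> R) a M :
  (forall m, 0 <= c m) -> \sum_(m < M) c m <= \sum_(m < a) c m + \sum_(m < M) c (a + m)%N.
Proof.
move=> c0; apply: (@le_trans _ _ (\sum_(m < M + a) c m)).
  by rewrite big_split_ord /= lerDl sumr_ge0.
by rewrite addnC big_split_ord.
Qed.

Lemma sum_geometric_tail (R : realFieldType) (x : R) (c : nat -> R) a b M :
  0 <= x < 1 -> (forall m, 0 <= c m) -> (forall m, c (a + m)%N = x ^+ (b + m./2)) ->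
  \sum_(m < M) c m <= \sum_(m < a) c m + x ^+ b * (2 / (1 - x)).
Proof.
move=> x01 c0 cE.
apply: le_trans (ler_sum_ord_addr a M c0) _.
rewrite lerD2l /=; under eq_bigr do rewrite cE exprD.
by rewrite -mulr_sumr ler_wpM2l ?exprn_ge0 ?geometric_halves //; case/andP: x01.
Qed.

(** * Mean index over spheres, and over balls in rank 2 *)

Lemma bad_words_ratio (R : realFieldType) k m l n : (0 < k)%N -> (0 < n)%N ->
  (forall w : seq (letter k), reduced w -> w != [::] -> (size w <= l.*2)%N ->
     (word_index w <= m)%N) ->
  (size (bad_words k m n))%:R <=
    (k.*2.-1)%:R^-1 ^+ l * (size (reduced_words k n))%:R :> R.
Proof.
move=> k0 n0 short; have q0 : 0 < (k.*2.-1)%:R :> R by rewrite ltr0n; case: k k0 {short}.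
rewrite exprVn mulrC ler_pdivlMr ?exprn_gt0 // mulrC -natrX -natrM ler_nat.
exact: bad_words_girth.
Qed.

Lemma bad_words_ratio_half (R : realFieldType) k m n : (0 < k)%N -> (0 < n)%N -> (0 < m)%N ->
  (size (bad_words k m n))%:R <=
    (k.*2.-1)%:R^-1 ^+ m.-1./2 * (size (reduced_words k n))%:R :> R.
Proof.
move=> k0 n0 m0; apply: bad_words_ratio => // w rw w0 wm.
by apply: leq_trans (word_index_le_size rw w0) _; lia.
Qed.

Lemma bad_words_ratio2 (R : realFieldType) k n : (0 < k)%N -> (0 < n)%N ->
  (size (bad_words k 2 n))%:R <=
    2 * (k.*2.-1)%:R^-1 * (size (reduced_words k n))%:R :> R.
Proof.
move=> k0 n0; have q0 : 0 < (k.*2.-1)%:R :> R by rewrite ltr0n; case: k k0.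
rewrite mulrAC ler_pdivlMr // mulrC -!natrM ler_nat.
exact: bad_words2.
Qed.

Lemma sphere_bound_large (R : realFieldType) k n : (2 < k)%N -> (0 < n)%N ->
  (\sum_(w <- reduced_words k n) word_index w)%N%:R <=
    2925 / 1000 * (size (reduced_words k n))%:R :> R.
Proof.
move=> k2 n0; have k0 : (0 < k)%N by lia.
pose x : R := (k.*2.-1)%:R^-1.
have x0 : 0 < x by rewrite invr_gt0 ltr0n; lia.
have x5 : x <= 1 / 5.
  by rewrite div1r lef_pV2 ?posrE ?ltr0n // ?ler_nat; lia.
pose c m := if (m < 2)%N then 1 else if m == 2 then 2 * x else x ^+ m.-1./2.
have c0 m : 0 <= c m.
  by rewrite /c; case: ifP => // _; case: ifP => _; rewrite ?exprn_ge0 ?mulr_ge0 ?ltW.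
apply: le_trans (sum_word_index_le (c := c) n0 _) _.
  move=> m; rewrite /c; case: ifP => m2; first by rewrite mul1r ler_nat size_bad_words_le.
  case: eqP => [->|_]; first exact: bad_words_ratio2.
  by apply: bad_words_ratio_half => //; case: m m2.
apply: ler_wpM2r => //.
apply: le_trans (@sum_geometric_tail _ x c 3 1 n.+1 _ c0 _) _; first by lra.
  by move=> m; rewrite /c /=.
rewrite !big_ord_recl big_ord0 /c /= expr1.
have y0 : 0 < 1 - x by lra.
(* At [x = 1/5] the total is 1 + 1 + 2/5 + 1/2 = 29/10. *)
have : x * (2 / (1 - x)) <= 1 / 2 by rewrite mulrA ler_pdivrMr //; lra.
lra.
Qed.

Lemma sphere_bound2 (R : realFieldType) n : (0 < n)%N ->
  (\sum_(w <- reduced_words 2 n) word_index w)%N%:R <=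
    29 / 9 * (size (reduced_words 2 n))%:R :> R.
Proof.
move=> n0; pose x : R := 3^-1.
(* From [m = 3] on, words of length at most 4 have index at most [m], which allows [l = 2]; the
   general exponent exceeds 2 only from [m = 7]. *)
pose c m : R := if (m < 2)%N then 1 else if m == 2 then 2 * x else
  if (m < 7)%N then x ^+ 2 else x ^+ m.-1./2.
have x0 : 0 < x by rewrite invr_gt0 ltr0n.
have c0 m : 0 <= c m.
  by rewrite /c; do ![case: ifP => // _]; rewrite ?exprn_ge0 ?mulr_ge0 ?ltW.
apply: le_trans (sum_word_index_le (c := c) n0 _) _.
  move=> m; rewrite /c; case: ifP => m2; first by rewrite mul1r ler_nat size_bad_words_le.
  case: eqP => [->|m3]; first exact: bad_words_ratio2.
  case: ifP => _; last by apply: bad_words_ratio_half => //; case: m m2 {m3}.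
  apply: bad_words_ratio => // w rw w0 w4; apply: leq_trans (word_index2_le3 rw w0 w4) _; lia.
apply: ler_wpM2r => //.
apply: le_trans (@sum_geometric_tail _ x c 7 3 n.+1 _ c0 _) _; first by rewrite /x; lra.
  by move=> m; rewrite /c /=.
rewrite !big_ord_recl big_ord0 /c /= /x.
(* The total is 1 + 1 + 2/3 + 4/9 + 3/27 = 29/9. *)
have -> : 2 / (1 - 3^-1) = 3 :> R by field.
lra.
Qed.

Lemma sphere_bound_odd (R : realFieldType) k n : odd n ->
  (\sum_(w <- reduced_words k n) word_index w)%N%:R <=
    2 * (size (reduced_words k n))%:R :> R.
Proof.
move=> n_odd; rewrite -natrM ler_nat mulnC -sum1_size big_distrl /=.
rewrite !big_seq; apply: leq_sum => w; rewrite mem_reduced_words => /andP[rw /eqP wn].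
by apply: word_index_odd_size; rewrite ?wn.
Qed.

(* Odd spheres have mean 2, and the next even sphere, three times as large, has
   mean at most 29/9: the mean over both is at most 35/12. *)
Lemma ball_bound2 (R : realFieldType) N :
  \sum_(n < N) (\sum_(w <- reduced_words 2 n.+1) word_index w)%N%:R <=
    35 / 12 * \sum_(n < N) (size (reduced_words 2 n.+1))%:R :> R.
Proof.
have sizeS n : (size (reduced_words 2 n.+2))%:R = 3 * (size (reduced_words 2 n.+1))%:R :> R.
  by rewrite size_reduced_wordsS natrM.
have even_bound j :
  \sum_(n < j.*2) (\sum_(w <- reduced_words 2 n.+1) word_index w)%N%:R <=
    35 / 12 * \sum_(n < j.*2) (size (reduced_words 2 n.+1))%:R :> R.
  elim: j => [|j IHj]; first by rewrite !big_ord0 mulr0.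
  rewrite doubleS !big_ord_recr /= !sizeS.
  have := @sphere_bound2 R j.*2.+2 isT; rewrite sizeS.
  have := @sphere_bound_odd R 2 j.*2.+1; rewrite /= odd_double => /(_ isT).
  lra.
rewrite -(odd_double_half N); case: (odd N) => /=; last exact: even_bound.
(* For odd [N] the unpaired last sphere has odd length, hence mean at most 2. *)
rewrite add1n !big_ord_recr /=.
have := @sphere_bound_odd R 2 N./2.*2.+1; rewrite /= odd_double => /(_ isT).
have := even_bound N./2; have := ler0n R (size (reduced_words 2 N./2.*2.+1)).
lra.
Qed.

(** * Rank 1: mean index over balls *)

Lemma bad_words1_dvd d m n :
  (forall w : seq (letter 1), reduced w -> size w = n -> (m < word_index w)%N -> d %| n)%N ->
  (size (bad_words 1 m n) <= (d %| n) * size (reduced_words 1 n))%N.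
Proof.
move=> bad_d; case: (boolP (d %| n)%N) => [_|ndvd]; first by rewrite mul1n size_bad_words_le.
rewrite mul0n leqn0 size_filter -leqn0 leqNgt -has_count; apply/hasPn => w.
rewrite mem_reduced_words => /andP[rw /eqP wn].
by apply: contra ndvd; apply: bad_d.
Qed.

Lemma inv_consecutive_sum (R : realFieldType) M :
  \sum_(m < M) ((m + 11) * (m + 10))%N%:R^-1 <= 10^-1 :> R.
Proof.
suff -> : \sum_(m < M) ((m + 11) * (m + 10))%N%:R^-1 = 10^-1 - (M + 10)%N%:R^-1 :> R.
  by rewrite gerBl invr_ge0.
elim: M => [|M IHM]; first by rewrite big_ord0 add0n subrr.
rewrite big_ord_recr /= IHM natrM !natrD -[M.+1%:R]natr1.
have M0 := ler0n R M; field; rewrite !lt0r_neq0 //; lra.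
Qed.

(* A divisor of [lcm(1, ..., m)]; for [m >= 11] the inverses of [m (m - 1)]
   telescope, and the crude bound is good enough. *)
Definition small_lcm m : nat :=
  if (m < 11)%N then nth 1%N [:: 1; 1; 2; 6; 12; 60; 60; 420; 420; 420; 420]%N m
  else (m * m.-1)%N.

Lemma small_lcm_dvd m n : (forall d, 0 < d <= m -> d %| n)%N -> (small_lcm m %| n)%N.
Proof.
move=> dvd_n; rewrite /small_lcm; case: ifP => [|m11].
  case: m dvd_n => [|[|[|[|[|[|[|[|[|[|[|m]]]]]]]]]]] // dvd_n _ /=.
  - exact: dvd_n.
  - by rewrite (@Gauss_dvd 2 3) // !dvd_n.
  - by rewrite (@Gauss_dvd 3 4) // !dvd_n.
  - by rewrite (@Gauss_dvd 5 12) // (@Gauss_dvd 3 4) // !dvd_n.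
  - by rewrite (@Gauss_dvd 5 12) // (@Gauss_dvd 3 4) // !dvd_n.
  1-4: by rewrite (@Gauss_dvd 7 60) // (@Gauss_dvd 5 12) // (@Gauss_dvd 3 4) // !dvd_n.
case: m dvd_n m11 => // m dvd_n m11; rewrite Gauss_dvd ?coprimeSn //= !dvd_n //; lia.
Qed.

(** The terms with [m < 11] add up to less than 2.793, and the tail to at most 1/10. *)
Lemma sum_inv_small_lcm (R : realFieldType) M :
  \sum_(m < M) (small_lcm m)%:R^-1 <= 2925 / 1000 :> R.
Proof.
apply: le_trans (@ler_sum_ord_addr _ (fun m => (small_lcm m)%:R^-1) 11 M _) _.
  by move=> m; rewrite invr_ge0.
have -> : \sum_(m < M) (small_lcm (11 + m))%:R^-1 =
    \sum_(m < M) ((m + 11) * (m + 10))%N%:R^-1 :> R.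
  by apply: eq_bigr => m _; rewrite /small_lcm /= [(m + 11)%N]addnC [(m + 10)%N]addnC.
have := inv_consecutive_sum R M.
by rewrite !big_ord_recl big_ord0 /small_lcm /=; lra.
Qed.

Lemma count_multiples_le (R : realFieldType) d N :
  \sum_(n < N) (d %| n.+1)%N%:R <= N%:R / d%:R :> R.
Proof.
rewrite -natr_sum -(big_mkord xpredT (fun n => nat_of_bool (d %| n.+1)%N)) /=.
have := divn_count_dvd d N; rewrite big_add1 /= => <-.
have [->|d0] := posnP d; first by rewrite divn0 invr0 mulr0.
by rewrite ler_pdivlMr ?ltr0n // -natrM ler_nat leq_trunc_div.
Qed.

(** Single spheres have no uniform bound here, the index at length [n] being the least non-divisor
    of [n]. Instead, for each threshold [m], the multiples of [small_lcm m] up to [N] are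
    counted. *)
Lemma ball_bound1 (R : realFieldType) N :
  \sum_(n < N) (\sum_(w <- reduced_words 1 n.+1) word_index w)%N%:R <=
    2925 / 1000 * \sum_(n < N) (size (reduced_words 1 n.+1))%:R :> R.
Proof.
have s2 n : size (reduced_words 1 n.+1) = 2%N by rewrite size_reduced_words exp1n.
under [X in _ * X]eq_bigr do rewrite s2.
rewrite sumr_const card_ord.
pose c n m : R := (small_lcm m %| n)%N%:R.
apply: (@le_trans _ _ (\sum_(n < N) \sum_(m < N.+1) c n.+1 m * 2)).
  apply: ler_sum => n _; apply: le_trans (sum_word_index_le (c := c n.+1) _ _) _ => //.
    move=> m; rewrite -natrM ler_nat; apply: bad_words1_dvd => w rw wn mw.
    by apply: small_lcm_dvd => d dm; rewrite -wn; apply: word_index1_dvd mw dm.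
  (* All lengths get the same range of thresholds, so that the two sums can be exchanged. *)
  rewrite s2 mulr_suml (big_ord_widen N.+1 (fun m => c n.+1 m * 2)) ?ltnS //.
  by rewrite big_mkcond ler_sum // => m _; case: ifP => // _; rewrite mulr_ge0.
rewrite exchange_big /=.
apply: (@le_trans _ _ (\sum_(m < N.+1) (N%:R * 2) * (small_lcm m)%:R^-1)).
  apply: ler_sum => m _; rewrite -mulr_suml mulrAC ler_wpM2r //.
  exact: count_multiples_le.
rewrite -mulr_sumr mulrC -[2 *+ N]mulr_natr [2 * _]mulrC ler_wpM2r ?mulr_ge0 //.
exact: sum_inv_small_lcm.
Qed.

(** * Balls in every rank *)

Lemma ball_bound (R : realFieldType) k N : (0 < k)%N ->
  \sum_(n < N) (\sum_(w <- reduced_words k n.+1) word_index w)%N%:R <=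
    2925 / 1000 * \sum_(n < N) (size (reduced_words k n.+1))%:R :> R.
Proof.
case: k => [|[|[|k]]] // _; first exact: ball_bound1.
  apply: le_trans (ball_bound2 R N) _; apply: ler_wpM2r; first by rewrite sumr_ge0.
  lra.
by rewrite mulr_sumr; apply: ler_sum => n _; apply: sphere_bound_large.
Qed.

(** The ball is the disjoint union of the spheres of radius 1 to [N]. *)
Lemma big_nontrivial_ball (V : nmodType) k N (f : free_group k -> V) :
  \sum_(g \in nontrivial_ball k N) f g =
  \sum_(n < N) \sum_(w <- reduced_words k n.+1) f (insubd (fg_one k) w).
Proof.
rewrite fsbig_finite; last exact: finite_nontrivial_ball.
rewrite -(big_mkord xpredT
  (fun n => \sum_(w <- reduced_words k n.+1) f (insubd (fg_one k) w))).
rewrite -(big_allpairs_dep (h := fun n w => insubd (fg_one k) w)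
  (r2 := fun n => reduced_words k n.+1)) /=.
apply: perm_big; apply: uniq_perm; first exact: fset_uniq.
  apply: allpairs_uniq_dep => [|n _|]; [exact: iota_uniq | exact: reduced_words_uniq |].
  move=> _ _ /allpairsPdep[n [w [_ + ->]]] /allpairsPdep[m [v [_ + ->]]] /=.
  rewrite !mem_reduced_words => /andP[rw /eqP wn] /andP[rv /eqP vm] E.
  have wv : w = v by rewrite -(word_insubd rw) E word_insubd.
  have [nm] : n.+1 = m.+1 by rewrite -wn -vm wv.
  by rewrite nm wv.
move=> g; rewrite in_fset_set; last exact: finite_nontrivial_ball.
apply/idP/allpairsPdep => [|[n [w [+ + ->]]]].
  rewrite inE => -[g1 gN]; exists (word_length g).-1, (word g).
  have l0 : (0 < word_length g)%N.
    rewrite lt0n /word_length size_eq0; apply: contraNneq g1 => g0.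
    by apply/eqP/val_inj.
  rewrite mem_reduced_words word_reduced prednK // mem_index_iota.
  by split=> //; [lia | exact: eqxx | apply/val_inj/esym/word_insubd/word_reduced].
rewrite mem_index_iota mem_reduced_words => nN /andP[rw /eqP wn].
rewrite inE /nontrivial_ball /=; split; last by rewrite /word_length word_insubd // wn.
by apply: contra_eq_neq wn => /(congr1 val); rewrite /= word_insubd // => ->.
Qed.

Theorem theorem6p4 (R : realType) (k : nat) (k_gt0 : (0 < k)%N) :
  exists C : R,
    `|C - 292%:R / 100%:R| <= 5%:R / 1000%:R /\
    forall N : nat, (0 < N)%N ->
      (\sum_(g \in nontrivial_ball k N) ((min_index g)%:R : R))
        / #|` fset_set (nontrivial_ball k N)|%:R <= C.
Proof.
(* The largest value within the allowed distance of 2.92; the worst case, rank 2, gives 35/12. *)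
exists (2925 / 1000); split; first by rewrite ger0_norm; lra.
move=> N N0; have cardE : #|` fset_set (nontrivial_ball k N)|%:R =
    \sum_(n < N) (size (reduced_words k n.+1))%:R :> R.
  rewrite -sum1_size natr_sum.
  have <- := @fsbig_finite _ _ +%R _ _ (fun=> 1 : R) (finite_nontrivial_ball k N).
  rewrite big_nontrivial_ball.
  by apply: eq_bigr => n _; rewrite -sum1_size natr_sum.
rewrite cardE big_nontrivial_ball ler_pdivrMr; last first.
  case: N N0 {cardE} => // N _; rewrite big_ord_recl ltr_wpDr ?sumr_ge0 //.
  by rewrite ltr0n size_reduced_words1 double_gt0.
under eq_bigr do rewrite -natr_sum.
exact: ball_bound.
Qed.
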